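(* Let $X$ be the real space $\ell_\infty^{(2)}$, i.e. $\mathbb{R}^2$ with the norm $\|(a,b)\|=\max\{|a|,|b|\}$. Let $\delta\in(0,2)$ and $\mu,\theta\in[0,1]$ satisfy $\mu\theta>1-\delta$. Then there exists a pair $(x,x^* )\in X\times X^*$ with $\|x\|=\mu$, $\|x^*\|=\theta$, $x^*(x)\geq 1-\delta$, and such that $$d_\infty\big((x,x^* ),\Pi(X)\big)=\min\left\{\Psi(\mu,\theta,\delta),\,1+\mu,\,1+\theta\right\}.$$ Therefore, $\Phi_X(\mu,\theta,\delta)=\min\left\{\Psi(\mu,\theta,\delta),\,1+\mu,\,1+\theta\right\}$ for all such values of $\delta,\mu,\theta$.
   Context: For a Banach space $X$ with dual $X^*$, let $\Pi(X):=\{(x,x^* )\in X\times X^* : \|x\|=\|x^*\|=x^*(x)=1\}$. For $(x,x^* )\in X\times X^*$ put $$d_\infty\big((x,x^* ),\Pi(X)\big):=\inf\big\{\max\{\|x-y\|,\|x^*-y^*\|\} : (y,y^* )\in\Pi(X)\big\}.$$ For $\delta\in(0,2)$ and $\mu,\theta\in[0,1]$ with $\mu\theta\geq 1-\delta$ define $$\Phi_X(\mu,\theta,\delta):=\sup\left\{d_\infty\big((x,x^* ),\Pi(X)\big) : x\in X,\ x^*\in X^*,\ \|x\|=\mu,\ \|x^*\|=\theta,\ \operatorname{Re} x^*(x)\geq 1-\delta\right\}.$$ For $\delta\in(0,2)$ and $\mu,\theta\in[0,1]$ with $\mu\theta>1-\delta$ define $$\Psi(\mu,\theta,\delta):=\frac{2-\mu-\theta+\sqrt{(\mu-\theta)^2+8(\mu\theta-1+\delta)}}{2}.$$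 *)

(* Defs.v *)
From HB Require Import structures.
From mathcomp Require Import all_boot all_order all_algebra.
From mathcomp Require Import all_classical all_reals all_analysis.
Set Implicit Arguments.
Unset Strict Implicit.
Unset Printing Implicit Defensive.
Import Order.TTheory GRing.Theory Num.Theory.
Import numFieldNormedType.Exports.
Local Open Scope classical_set_scope.
Local Open Scope ring_scope.

(* Only real Banach spaces are considered, so Re x^*(x) is x^*(x). *)

Record dual (R : realType) (X : completeNormedModType R) := Dual {
  dual_fun :> {linear X -> R^o} ;
  dual_continuous : continuous dual_fun }.

(* Stated for plain functions, so that it applies to the difference f \- g of
   two functionals. For a continuous linear f the set is nonempty and bounded,
   so that the real-valued sup is the actual supremum. *)
Definition dual_norm (R : realType) (X : completeNormedModType R)
    (f : X -> R) : R :=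
  sup [set `|f x| | x in [set x : X | `|x| <= 1]].

Definition Pi (R : realType) (X : completeNormedModType R) :
    set (X * dual X) :=
  [set p : X * dual X | [/\ `|p.1| = 1, dual_norm p.2 = 1 & p.2 p.1 = 1]].

(* The set is bounded below by 0, and nonempty when A is, so that inf is the
   actual infimum whenever A is nonempty. *)
Definition dinfty (R : realType) (X : completeNormedModType R)
    (p : X * dual X) (A : set (X * dual X)) : R :=
  inf [set Num.max `|p.1 - q.1| (dual_norm (p.2 \- q.2)) | q in A].

(* If X is not trivial, mu and theta are in [0, 1] and 1 - delta <= mu * theta,
   the set is nonempty and bounded by 2, so that sup is the actual supremum. *)
Definition Phi (R : realType) (X : completeNormedModType R)
    (mu theta delta : R) : R :=
  sup [set dinfty p (@Pi R X) | p in
    [set p : X * dual X |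
      [/\ `|p.1| = mu, dual_norm p.2 = theta & 1 - delta <= p.2 p.1]]].

Definition Psi (R : realType) (mu theta delta : R) : R :=
  (2 - mu - theta
     + Num.sqrt ((mu - theta) ^+ 2 + 8 * (mu * theta - 1 + delta))) / 2.

HB.instance Definition _ (R : realType) (m n : nat) :=
  Complete.on 'M[R]_(m, n).

(* Real l_infty^(2): the norm of matrices is the maximum of the absolute values
   of the entries, see linf2_normE. *)
Definition linf2 (R : realType) : completeNormedModType R := 'rV[R]_2.

Lemma linf2_normE (R : realType) (a b : R) :
  `|(\row_j [:: a; b]`_j : linf2 R)| = Num.max `|a| `|b|.
Proof.
have -> : `|(\row_j [:: a; b]`_j : linf2 R)| =
    \big[Num.max/0]_(i : 'I_1 * 'I_2) `|(\row_j [:: a; b]`_j : 'rV[R]_2) i.1 i.2|.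
  exact: mx_normrE.
apply/le_anti/andP; split.
  apply/bigmax_leP; split=> [|[i j] _]; first by rewrite le_max normr_ge0.
  by rewrite mxE; case: j => [[|[|j]]] //= _; rewrite le_max lexx ?orbT.
rewrite ge_max; apply/andP; split.
  by apply/bigmax_geP; right; exists (ord0, ord0); rewrite // mxE.
by apply/bigmax_geP; right; exists (ord0, ord_max); rewrite // mxE.
Qed.

(* Main.v *)
Require Import Defs.
From HB Require Import structures.
From mathcomp Require Import all_boot all_order all_algebra.
From mathcomp Require Import all_classical all_reals all_analysis.
From mathcomp Require Import lra ring.
Import Order.TTheory GRing.Theory Num.Theory.
Import numFieldNormedType.Exports.
Local Open Scope classical_set_scope.
Local Open Scope ring_scope.

(** In the plane with the maximum norm, whose dual norm is the sum norm, the
    norming pairs are explicit: the functionals [(1, 0)] and [(0, 1)], up to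
    sign, are normed by a whole edge of the unit square, and every other
    functional of norm 1 by exactly one corner. Everything is thus reduced to inequalities between the four coordinates of a vector
    [(a, b)] and a functional [(p, q)], through [dinfty_le] and [dinfty_ge].

    The number [e = Psi mu theta delta] is governed by the equation
    [(e - 1 + mu) * (e - 1 + theta) = 2 * (mu * theta - 1 + delta)]
    ([Psi_root]). For the upper bound one may assume, by the symmetries of the
    square ([near_state_reduction]), that [|b| <= a = mu] and [0 <= q]. If the
    edge and the corner states near the given pair were all farther than [e],
    the left side of the equation would be smaller than the right side
    ([near_state_root]). The bounds [1 + mu] and [1 + theta] come from matching
    only the functional, or only the vector, and using the triangle inequality
    for the other component.

    For the lower bound let [e] be the minimum in the theorem. The vector
    [(mu, 1 - e)] with the functional
    [((1 + theta - e) / 2, (theta - 1 + e) / 2)] is at distance at least [e]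
    from every norming pair ([far_from_state]). The bounds [e <= 1 + mu] and
    [e <= 1 + theta] make its norms [mu] and [theta], and its pairing is
    [mu * theta - (e - 1 + mu) * (e - 1 + theta) / 2], which is at least
    [1 - delta] because [e <= Psi mu theta delta]. With the upper bound,
    the supremum is attained at this pair. *)

(** * Coordinates on the plane and its dual *)

Definition pt {R : realType} (a b : R) : linf2 R := \row_j [:: a; b]`_j.

Lemma pt_eta {R : realType} (x : linf2 R) : x = pt (x 0 0) (x 0 1).
Proof.
apply/rowP => j; rewrite mxE; case: j => [[|[|j]]] //= Hj.
  by congr (x _ _); apply/val_inj.
by congr (x _ _); apply/val_inj.
Qed.

Lemma pt0 {R : realType} (a b : R) : pt a b 0 0 = a.
Proof. by rewrite mxE. Qed.

Lemma pt1 {R : realType} (a b : R) : pt a b 0 1 = b.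
Proof. by rewrite mxE. Qed.

Lemma norm_pt {R : realType} (a b : R) : `|pt a b| = Num.max `|a| `|b|.
Proof. exact: linf2_normE. Qed.

Lemma ptB {R : realType} (a b c d : R) :
  pt a b - pt c d = pt (a - c) (b - d).
Proof. by apply/rowP => j; rewrite !mxE; case: j => [[|[|j]]]. Qed.

Definition coord_form {R : realType} (p q : R) (x : linf2 R) : R^o :=
  p * x 0 0 + q * x 0 1.

Lemma coord_form_linear {R : realType} (p q : R) : linear (coord_form p q).
Proof. by move=> k x y; rewrite /coord_form !mxE /GRing.scale /=; ring. Qed.

HB.instance Definition _ (R : realType) (p q : R) :=
  GRing.isLinear.Build R (linf2 R) R^o _ (coord_form p q) (coord_form_linear p q).

Lemma coord_form_continuous {R : realType} (p q : R) : continuous (coord_form p q).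
Proof.
have cont_coord k i : continuous (fun x : linf2 R => k * x 0 i : R^o).
  by move=> x; apply: (@continuous_comp _ _ _ (fun x : linf2 R => x 0 i) ( *%R k));
    [exact: coord_continuous | exact: mulrl_continuous].
by move=> x; exact: (cvgD (cont_coord p 0 x) (cont_coord q 1 x)).
Qed.

Definition dual_pt {R : realType} (p q : R) : dual (linf2 R) :=
  @Dual R (linf2 R) (coord_form p q) (coord_form_continuous p q).

Lemma dual_coord {R : realType} (f : dual (linf2 R)) (x : linf2 R) :
  f x = coord_form (f (pt 1 0)) (f (pt 0 1)) x.
Proof.
have {1}-> : x = x 0 0 *: pt 1 0 + x 0 1 *: pt 0 1.
  rewrite {1}(pt_eta x); apply/rowP => j; rewrite !mxE.
  by case: j => [[|[|j]]] //= _; ring.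
by rewrite linearD !linearZ /coord_form ![f _ * _]mulrC.
Qed.

(** The supremum is attained at the sign vector of [(p, q)]. *)
Lemma dual_norm_coord_form {R : realType} (f : linf2 R -> R) (p q : R) :
  f =1 coord_form p q -> dual_norm f = `|p| + `|q|.
Proof.
move=> fE.
rewrite /dual_norm; set S := (S in sup S).
have ubS : ubound S (`|p| + `|q|).
  move=> _ [x /= + <-]; rewrite fE (pt_eta x) norm_pt /coord_form pt0 pt1 ge_max.
  move=> /andP[x0 x1]; apply: (le_trans (ler_normD _ _)); rewrite !normrM.
  by apply: lerD; apply: ler_piMr.
apply/le_anti/andP; split.
  apply: ge_sup ubS.
  by exists `|f 0|, 0; rewrite /= ?normr0.
apply: ub_le_sup; first by exists (`|p| + `|q|).
exists (pt (Num.sg p) (Num.sg q)).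
  by rewrite /= norm_pt ge_max !normr_sg !lern1 !leq_b1.
by rewrite fE /coord_form pt0 pt1 ![_ * Num.sg _]mulrC -!normrEsg ger0_norm // addr_ge0.
Qed.

Lemma dual_ptE {R : realType} (p q a b : R) : dual_pt p q (pt a b) = p * a + q * b.
Proof. by rewrite /= /coord_form pt0 pt1. Qed.

Lemma dual_norm_coord {R : realType} (f : dual (linf2 R)) :
  dual_norm f = `|f (pt 1 0)| + `|f (pt 0 1)|.
Proof. exact/dual_norm_coord_form/dual_coord. Qed.

Lemma dual_normB_coord {R : realType} (f g : dual (linf2 R)) :
  dual_norm (f \- g) =
  `|(f (pt 1 0) : R) - g (pt 1 0)| + `|(f (pt 0 1) : R) - g (pt 0 1)|.
Proof.
apply: dual_norm_coord_form => x /=.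
by rewrite (dual_coord f) (dual_coord g) /coord_form; ring.
Qed.

(** * The distance to the norming pairs in coordinates *)

(** Membership of the pair with vector [(c, d)] and functional [(r, s)] in the
    set [Pi]. *)
Definition state_pair {R : realType} (c d r s : R) : Prop :=
  [/\ Num.max `|c| `|d| = 1, `|r| + `|s| = 1 & r * c + s * d = 1].

(** A norming pair is exhibited, instead of bounding the infimum, so that a
    symmetry of the square can be applied to that pair directly. *)
Definition near_state {R : realType} (e a b p q : R) : Prop :=
  exists c d r s, [/\ state_pair c d r s,
    Num.max `|a - c| `|b - d| <= e & `|p - r| + `|q - s| <= e].

Lemma Pi_coord {R : realType} (y : linf2 R) (f : dual (linf2 R)) :
  Pi (y, f) <-> state_pair (y 0 0) (y 0 1) (f (pt 1 0)) (f (pt 0 1)).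
Proof.
by rewrite /Pi /state_pair /= dual_norm_coord (dual_coord f y) {1}(pt_eta y) norm_pt.
Qed.

Lemma dinfty_le {R : realType} (e : R) (x : linf2 R) (f : dual (linf2 R)) :
  near_state e (x 0 0) (x 0 1) (f (pt 1 0)) (f (pt 0 1)) ->
  dinfty (x, f) (@Pi R (linf2 R)) <= e.
Proof.
move=> [c [d [r [s [cdrs xe fe]]]]].
apply: (@le_trans _ _ (Num.max `|x - pt c d| (dual_norm (f \- dual_pt r s)))).
  apply: ge_inf; first by exists 0 => _ [q _ <-]; rewrite le_max normr_ge0.
  exists (pt c d, dual_pt r s) => //=; apply/Pi_coord.
  by rewrite !dual_ptE pt0 pt1 !mulr0 !mulr1 addr0 add0r.
rewrite ge_max {1}(pt_eta x) ptB norm_pt xe (dual_normB_coord f (dual_pt r s)) !dual_ptE.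
by rewrite !mulr0 !mulr1 addr0 add0r.
Qed.

Lemma dinfty_ge {R : realType} (e a b p q : R) :
  (forall c d r s, state_pair c d r s ->
    e <= Num.max (Num.max `|a - c| `|b - d|) (`|p - r| + `|q - s|)) ->
  e <= dinfty (pt a b, dual_pt p q) (@Pi R (linf2 R)).
Proof.
move=> far; apply: lb_le_inf.
  eexists; exists (pt 1 1, dual_pt 1 0) => //; apply/Pi_coord.
  rewrite !dual_ptE pt0 pt1; split; rewrite ?mulr0 ?mulr1 ?mul0r ?addr0 ?normr1 //.
    by rewrite maxxx.
  by rewrite normr0 addr0.
move=> _ [[y g] /Pi_coord yg <-] /=; have := far _ _ _ _ yg.
rewrite {3}(pt_eta y) ptB norm_pt (dual_normB_coord (dual_pt p q) g) !dual_ptE.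
by rewrite !mulr0 !mulr1 addr0 add0r.
Qed.

(** * The symmetries of the square *)

Definition admissible {R : realType} (mu theta delta a b p q : R) : Prop :=
  [/\ Num.max `|a| `|b| = mu, `|p| + `|q| = theta & 1 - delta <= p * a + q * b].

Lemma state_pair_swap {R : realType} (c d r s : R) :
  state_pair d c s r -> state_pair c d r s.
Proof. by rewrite /state_pair maxC [`|r| + _]addrC [r * c + _]addrC. Qed.

Lemma state_pair_opp1 {R : realType} (c d r s : R) :
  state_pair c d r s -> state_pair (- c) d (- r) s.
Proof. by case=> ? ? ?; split; rewrite ?normrN ?mulrNN. Qed.

Lemma near_state_swap {R : realType} (e a b p q : R) :
  near_state e b a q p -> near_state e a b p q.
Proof.
move=> [c [d [r [s [/state_pair_swap ? ? ?]]]]].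
by exists d, c, s, r; split=> //; [rewrite maxC | rewrite addrC].
Qed.

Lemma near_state_opp1 {R : realType} (e a b p q : R) :
  near_state e (- a) b (- p) q -> near_state e a b p q.
Proof.
move=> [c [d [r [s [/state_pair_opp1 ? xc pr]]]]].
exists (- c), d, (- r), s; split=> //.
  by rewrite -[`|a - _|]normrN opprD opprK.
by rewrite -[`|p - _|]normrN opprD opprK.
Qed.

Lemma admissible_swap {R : realType} (mu theta delta a b p q : R) :
  admissible mu theta delta a b p q -> admissible mu theta delta b a q p.
Proof. by rewrite /admissible maxC [`|p| + _]addrC [p * a + _]addrC. Qed.

Lemma admissible_opp1 {R : realType} (mu theta delta a b p q : R) :
  admissible mu theta delta a b p q ->
  admissible mu theta delta (- a) b (- p) q.
Proof. by case=> ? ? ?; split; rewrite ?normrN ?mulrNN. Qed.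

(** Exchanging the coordinates and changing the sign of one of them, in the
    vector and the functional at once, preserve norms and pairing; so it is
    enough to treat vectors whose first coordinate equals the norm and
    functionals whose second coordinate is nonnegative. *)
Lemma near_state_reduction {R : realType} (e mu theta delta : R) :
  (forall a b p q, admissible mu theta delta a b p q ->
    `|b| <= a -> 0 <= q -> near_state e a b p q) ->
  forall a b p q, admissible mu theta delta a b p q -> near_state e a b p q.
Proof.
move=> base.
have max_first a b p q : admissible mu theta delta a b p q -> `|b| <= a ->
    near_state e a b p q.
  move=> adm ba; have [q0|/ltW q0] := leP 0 q; first exact: base adm ba q0.
  apply: near_state_swap; apply: near_state_opp1; apply: near_state_swap.
  apply: base; rewrite ?normrN ?oppr_ge0 //.
  exact/admissible_swap/admissible_opp1/admissible_swap.
have dominant_first a b p q : admissible mu theta delta a b p q ->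
    `|b| <= `|a| -> near_state e a b p q.
  move=> adm; have [a0|a0] := ger0P a; first exact: max_first.
  move=> ba; apply: near_state_opp1; apply: max_first => //.
  exact: admissible_opp1.
move=> a b p q adm; have [ba|/ltW ab] := leP `|b| `|a|.
  exact: dominant_first.
by apply: near_state_swap; apply: dominant_first => //; apply: admissible_swap.
Qed.

(** * Upper bounds *)

(** If the dual coordinates are nonnegative, enlarging one of them to make the
    norm 1 costs only [1 - (p + q)], and the result attains its norm at the
    corner [(1, 1)]. *)
Lemma near_state_corner {R : realType} (e a b p q : R) :
  0 <= p -> 0 <= q -> p + q <= 1 -> 1 - (p + q) <= e ->
  Num.max `|a - 1| `|b - 1| <= e -> near_state e a b p q.
Proof.
move=> p0 q0 pq1 pqe ab; exists 1, 1, p, (1 - p); split=> //.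
  by split; rewrite ?normr1 ?maxxx ?(ger0_norm p0) ?ger0_norm; lra.
rewrite subrr normr0 (_ : q - _ = - (1 - (p + q))); last by lra.
by rewrite normrN ger0_norm; lra.
Qed.

(** The state at [(1, b)] with functional [(1, 0)] is within [1 - mu] of the
    vector, and any two functionals of norms [theta] and 1 are within
    [1 + theta]. *)
Lemma near_state_add1_theta {R : realType} (mu theta delta a b p q : R) :
  mu <= 1 -> admissible mu theta delta a b p q -> near_state (1 + theta) a b p q.
Proof.
move=> mu1; move: a b p q; apply: (@near_state_reduction _ _ mu theta delta).
move=> a b p q [+ pq _] ba q0.
have a0 : 0 <= a by apply: le_trans ba.
rewrite max_l (ger0_norm a0) // => amu.
exists 1, b, 1, 0; split.
- split; rewrite ?normr1 ?normr0 ?addr0 ?mulr1 ?mul0r ?addr0 //.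
  by rewrite max_l //; lra.
- rewrite subrr normr0 ge_max ler_norml; have := normr_ge0 p.
  by have := normr_ge0 q; lra.
rewrite subr0; have := ler_normB p 1; rewrite normr1; lra.
Qed.

(** A functional of norm [theta] is within [1 - theta] of a functional of norm
    1 that attains its norm at a corner, and every point of the unit sphere is
    within [1 + mu] of the vector. *)
Lemma near_state_add1_mu {R : realType} (mu theta delta a b p q : R) :
  0 <= mu <= 1 -> theta <= 1 -> admissible mu theta delta a b p q ->
  near_state (1 + mu) a b p q.
Proof.
move=> mu01 th1; move: a b p q; apply: (@near_state_reduction _ _ mu theta delta).
move=> a b p q [+ pq _] ba q0.
have a0 : 0 <= a by apply: le_trans ba.
rewrite max_l (ger0_norm a0) // => amu.
move: ba pq; rewrite ler_norml (ger0_norm q0) => ba.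
have [p0|p0] := ger0P p => pq.
  by apply: near_state_corner; rewrite // ?ge_max ?ler_norml; lra.
apply: near_state_opp1.
by apply: near_state_corner; rewrite // ?ge_max ?ler_norml; lra.
Qed.

(** Put [A = e - 1 + mu] and [B = e - 1 + theta], so that the hypothesis on [e]
    reads [2 * (mu * theta - (1 - delta)) <= A * B]. Each candidate
    is a state on an edge of the square or at a corner, and its distance is
    affine in the coordinates of the given pair. If all the candidates were
    farther than [e], the lower bound [1 - delta] on the pairing would give
    [2 * (mu * theta - (1 - delta)) > A * B]. *)
Lemma near_state_root {R : realType} (mu theta delta e a b p q : R) :
  0 <= mu <= 1 -> 0 <= theta <= 1 ->
  1 - mu < e -> 1 - theta < e -> e <= 1 + mu -> e <= 1 + theta ->
  2 * (mu * theta - 1 + delta) <= (e - 1 + mu) * (e - 1 + theta) ->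
  admissible mu theta delta a b p q -> near_state e a b p q.
Proof.
move=> mu01 th01 emu eth emu' eth' root; move: a b p q.
apply: (@near_state_reduction _ _ mu theta delta).
move=> a b p q [+ pq pairing] ba q0.
have a0 : 0 <= a by apply: le_trans ba.
rewrite max_l (ger0_norm a0) // => amu; subst a.
move: (ba) pq; rewrite ler_norml (ger0_norm q0) => /andP[bmu' bmu].
have [p0|p0] := ger0P p => pq.
- have [far1|far1] := leP (1 + theta - 2 * p) e.
    exists 1, b, 1, 0; split.
    + split; rewrite ?normr1 ?normr0 ?addr0 ?mulr1 ?mul0r ?addr0 //.
      by rewrite max_l //; lra.
    + rewrite ge_max subrr normr0 ler_norml; lra.
    + by rewrite subr0 (ger0_norm q0) distrC ger0_norm; lra.
  have [far2|far2] := leP (1 - b) e.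
    by apply: near_state_corner; rewrite // ?ge_max ?ler_norml; lra.
  (* With p + q = theta, the pairing gives
     (mu - b) * q <= mu * theta - (1 - delta), while both candidates being far
     means mu - b > A and 2 * q > B. *)
  exfalso.
  have : (e - 1 + mu) * (e - 1 + theta) < (mu - b) * (2 * q).
    by apply: ltr_pM; lra.
  have := root; nra.
(* For p < 0 the candidate is the functional (0, 1), at distances 1 - b and
   1 + theta - 2 * q. The pairing now gives
   2 * (theta * (mu - b) + (- p) * (mu + b)) <= 2 * (mu * theta - (1 - delta)),
   and e <= 1 + theta, e <= 1 + mu mean B <= 2 * theta, A <= 2 * mu. If
   mu - b > A, then the first term alone is too large. If 2 * (- p) > B, then
   replacing theta by - p in it leaves 4 * (- p) * mu, which is too large. *)
have far2 : 1 - b <= e.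
  rewrite leNgt; apply/negP => far2.
  have : (e - 1 + mu) * (e - 1 + theta) < (mu - b) * (2 * theta).
    apply: (@lt_le_trans _ _ ((mu - b) * (e - 1 + theta))).
      by rewrite ltr_pM2r; lra.
    by rewrite ler_pM2l; lra.
  have : 0 <= (- p) * (mu + b) by apply: mulr_ge0; lra.
  nra.
have far1 : 1 + theta - 2 * q <= e.
  rewrite leNgt; apply/negP => far1.
  have : (e - 1 + mu) * (e - 1 + theta) < (2 * mu) * (2 * - p).
    apply: (@le_lt_trans _ _ ((2 * mu) * (e - 1 + theta))).
      by rewrite ler_pM2r; lra.
    by rewrite ltr_pM2l; lra.
  have : 0 <= q * (mu - b) by apply: mulr_ge0; lra.
  nra.
exists mu, 1, 0, 1; split.
- split; rewrite ?normr1 ?normr0 ?add0r ?mulr1 ?mul0r ?add0r //.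
  by rewrite max_r // ger0_norm; lra.
- rewrite ge_max subrr normr0 ler_norml; lra.
- by rewrite subr0 (ltr0_norm p0) distrC ger0_norm; lra.
Qed.

(** * The extremal pair *)

(** The pair with vector [(mu, 1 - e)] and functional
    [((1 + theta - e) / 2, (theta - 1 + e) / 2)] is built so that either way of
    norming costs [e]. A functional with [s > 0] is normed only by vectors with
    second coordinate 1, which is [e] away from [1 - e]. If
    [s <= 0], let [(p, q)] be the given functional: then
    [|q - s| = q + |s| = q + 1 - |r|] and [|p - r| >= |r| - p], so that the
    distance is at least [1 + q - p = e]. *)
Lemma far_from_state {R : realType} (mu theta e c d r s : R) :
  1 - theta <= e -> e <= 1 + theta -> state_pair c d r s ->
  e <= Num.max (Num.max `|mu - c| `|(1 - e) - d|)
        (`|(1 + theta - e) / 2 - r| + `|(theta - 1 + e) / 2 - s|).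
Proof.
move=> eth eth' [cd rs pairing].
have /andP[_ d1] : (`|c| <= 1) && (`|d| <= 1) by rewrite -ge_max cd.
have c1 : `|c| <= 1 by rewrite -cd le_max lexx.
have [s0|s0] := ltP 0 s.
  have -> : d = 1.
    apply/le_anti/andP; split; first by apply: le_trans (ler_norm d) d1.
    have rc : r * c <= `|r|.
      by apply: le_trans (ler_norm _) _; rewrite normrM ler_piMr.
    by rewrite -(ler_pM2l s0); move: rs; rewrite (gtr0_norm s0); lra.
  rewrite (_ : 1 - e - 1 = - e); last by lra.
  by rewrite normrN !le_max ler_norm orbT.
rewrite le_max; apply/orP; right.
rewrite [`|_ - s|]ger0_norm; last lra.
move: rs; rewrite (ler0_norm s0) => rs.
set p := (1 + theta - e) / 2.
have p0 : 0 <= p by rewrite /p; lra.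
have := ler_normB p (p - r); rewrite subKr (ger0_norm p0) /p; lra.
Qed.

(** [Psi] is the larger root [e] of
    [(e - 1 + mu) * (e - 1 + theta) = 2 * (mu * theta - 1 + delta)], whose
    right side is positive, so both factors are positive there. *)
Lemma Psi_root {R : realType} (mu theta delta : R) :
  1 - delta < mu * theta ->
  [/\ 1 - mu < Psi mu theta delta, 1 - theta < Psi mu theta delta &
   (Psi mu theta delta - 1 + mu) * (Psi mu theta delta - 1 + theta) =
   2 * (mu * theta - 1 + delta)].
Proof.
move=> mth; rewrite /Psi; set D := (mu - theta) ^+ 2 + _; set S := Num.sqrt D.
have D0 : (mu - theta) ^+ 2 < D by rewrite /D; lra.
have S2 : S ^+ 2 = D by rewrite sqr_sqrtr //; have := sqr_ge0 (mu - theta); lra.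
have : `|mu - theta| < S by rewrite -sqrtr_sqr ltr_sqrt //; have := sqr_ge0 (mu - theta); lra.
rewrite ltr_norml => /andP[? ?]; split; [lra | lra |].
rewrite (_ : _ * _ = (S ^+ 2 - (mu - theta) ^+ 2) / 4); last by field.
by rewrite S2 /D; field.
Qed.

Lemma dinfty_upper {R : realType} (mu theta delta : R)
    (x : linf2 R) (f : dual (linf2 R)) :
  0 <= mu <= 1 -> 0 <= theta <= 1 -> 1 - delta < mu * theta ->
  `|x| = mu -> dual_norm f = theta -> 1 - delta <= f x ->
  dinfty (x, f) (@Pi R (linf2 R)) <=
    Num.min (Psi mu theta delta) (Num.min (1 + mu) (1 + theta)).
Proof.
move=> mu01 th01 mth xmu fth fx; apply: dinfty_le.
have adm : admissible mu theta delta (x 0 0) (x 0 1) (f (pt 1 0)) (f (pt 0 1)).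
  split; first by rewrite -norm_pt -pt_eta.
    by rewrite -dual_norm_coord.
  by move: fx; rewrite (dual_coord f x).
have [emu eth root] := Psi_root _ _ _ mth.
have [small|_] := leP (Psi mu theta delta) (Num.min (1 + mu) (1 + theta)).
  move: small; rewrite le_min => /andP[? ?].
  by apply: near_state_root adm => //; rewrite root.
have [_|_] := leP (1 + mu) (1 + theta).
  by apply: near_state_add1_mu adm => //; case/andP: th01.
by apply: near_state_add1_theta adm; case/andP: mu01.
Qed.

Theorem mainTheorem2 (R : realType) (delta mu theta : R)
    (delta02 : 0 < delta < 2) (mu01 : 0 <= mu <= 1) (theta01 : 0 <= theta <= 1)
    (mutheta : 1 - delta < mu * theta) :
  (exists (x : linf2 R) (xs : dual (linf2 R)),
     [/\ `|x| = mu, dual_norm xs = theta, 1 - delta <= xs x &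
         dinfty (x, xs) (@Pi R (linf2 R)) =
           Num.min (Psi mu theta delta) (Num.min (1 + mu) (1 + theta))])
  /\ Phi (linf2 R) mu theta delta =
       Num.min (Psi mu theta delta) (Num.min (1 + mu) (1 + theta)).
Proof.
set e := Num.min _ _.
have upper (x : linf2 R) (f : dual (linf2 R)) :
  `|x| = mu -> dual_norm f = theta -> 1 - delta <= f x ->
  dinfty (x, f) (@Pi R (linf2 R)) <= e by exact: dinfty_upper.
have attained : exists (x : linf2 R) (xs : dual (linf2 R)),
    [/\ `|x| = mu, dual_norm xs = theta, 1 - delta <= xs x &
      dinfty (x, xs) (@Pi R (linf2 R)) = e].
  have [psimu psith root] := Psi_root _ _ _ mutheta.
  have [epsi emu eth] : [/\ e <= Psi mu theta delta, e <= 1 + mu & e <= 1 + theta].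
    by split; rewrite /e !ge_min lexx ?orbT.
  have [mue the] : 1 - mu <= e /\ 1 - theta <= e.
    by split; rewrite /e !le_min; apply/and3P; split; lra.
  pose p := (1 + theta - e) / 2; pose q := (theta - 1 + e) / 2.
  have xmu : `|pt mu (1 - e)| = mu.
    rewrite norm_pt ger0_norm; last by lra.
    by apply: max_l; rewrite ler_norml; lra.
  have fth : dual_norm (dual_pt p q) = theta.
    rewrite dual_norm_coord !dual_ptE !mulr0 !mulr1 addr0 add0r.
    by rewrite !ger0_norm /p /q; lra.
  have fx : 1 - delta <= dual_pt p q (pt mu (1 - e)).
    rewrite dual_ptE.
    have : (e - 1 + mu) * (e - 1 + theta) <= 2 * (mu * theta - 1 + delta).
      by rewrite -root; apply: ler_pM; lra.
    by rewrite /p /q; nra.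
  exists (pt mu (1 - e)), (dual_pt p q); split=> //.
  apply/le_anti/andP; split; first exact: upper.
  by apply: dinfty_ge => c d r s; apply: far_from_state.
split=> //; apply/le_anti/andP; split.
  have [x [f [xmu fth fx _]]] := attained.
  apply: ge_sup; first by eexists; exists (x, f).
  by move=> _ [[y g] [/= ? ? ?] <-]; apply: upper.
have [x [f [xmu fth fx <-]]] := attained.
apply: ub_le_sup; last by exists (x, f).
by exists e => _ [[y g] [/= ? ? ?] <-]; apply: upper.
Qed.
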